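(* Let $d\ge1$, let $B$ be a symmetric rational $d\times d$ matrix, and let $d_1,\dots,d_d$ be positive integers. Let $t\ge1$, and for $1\le j\le t$ let $\lambda_j>0$ be real, $b_j=(b_{j,1},\dots,b_{j,d})\in\mathbb Q^d$ and $c_j\in\mathbb Q$; let $\kappa\in\mathbb Q$. Assume the series $\mathcal N_{b_j}(q)$ define Puiseux series bounded below with locally finite coefficients. If $$\sum_{j=1}^t\lambda_jq^{c_j}\mathcal N_{b_j}(q)\in q^\kappa\,\mathbb R((q)),$$ then every entry of $B$ is an integer. More precisely, for each $j$, $$c_j-\kappa\in\mathbb Z,\qquad b_{j,i}+B_{ii}/2\in\mathbb Z\quad(1\le i\le d).$$ Conversely, these conditions together with integrality of all entries of $B$ imply the displayed containment $\sum_j\lambda_jq^{c_j}\mathcal N_{b_j}(q)\in q^\kappa\mathbb R((q))$.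
   Context: With $(x;q)_n=\prod_{k=0}^{n-1}(1-xq^k)$, for $b\in\mathbb Q^d$ put $$\mathcal N_b(q)=\sum_{n\in\mathbb Z_{\ge0}^d}\frac{q^{\frac12n^{\mathsf T}Bn+b^{\mathsf T}n}}{\prod_{i=1}^d(q^{d_i};q^{d_i})_{n_i}},$$ viewed as a formal series in rational powers of $q$, where each reciprocal denominator is expanded as a power series in $q$. ''Puiseux series bounded below with locally finite coefficients'' means that the exponents are bounded below (with a common denominator) and each exponent receives only finitely many contributions from the sum; this holds, for example, when $n^{\mathsf T}Bn>0$ on the nonnegative cone away from $0$. $q^\kappa\mathbb R((q))$ is the set of $q^\kappa$ times formal Laurent series in integer powers of $q$ with finitely many negative powers. *)

(* Defs.v *)
From mathcomp Require Import all_boot all_order all_algebra.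
From mathcomp Require Import all_classical all_reals.

Set Implicit Arguments.
Unset Strict Implicit.
Unset Printing Implicit Defensive.

Import Order.TTheory GRing.Theory Num.Theory.
Local Open Scope classical_set_scope.
Local Open Scope ring_scope.

Definition qpoch (A : comNzRingType) (x q : A) (n : nat) : A :=
  \prod_(k < n) (1 - x * q ^+ k).

(* Coefficient of q^m in the power series 1/p = \sum_k (1 - p)^k, for p with
   constant coefficient 1; the powers k > m of 1 - p only have terms of degree
   greater than m.  See [psinvP]. *)
Definition psinv (A : comNzRingType) (p : {poly A}) (m : nat) : A :=
  (\sum_(k < m.+1) (1 - p) ^+ k)`_m.

(* A formal series in rational powers of q is represented by its coefficient
   function: [f e] is the coefficient of q^e. *)
Definition qseries (R : realType) : Type := rat -> R.

(* multiplication by q^c *)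
Definition qshift (R : realType) (c : rat) (f : qseries R) : qseries R :=
  fun e => f (e - c).

(* a power series in q, as a series in rational powers of q *)
Definition of_power_series (R : realType) (g : nat -> R) : qseries R :=
  fun e => if e \is a Num.nat then g (Num.truncn e) else 0.

(* a doubly infinite series in integer powers of q, likewise *)
Definition of_int_series (R : realType) (g : int -> R) : qseries R :=
  fun e => if e \is a Num.int then g (Num.floor e) else 0.

(* q^kappa R((q)) *)
Definition qLaurent (R : realType) (kappa : rat) : set (qseries R) :=
  [set f | exists2 g : int -> R,
     exists N : int, forall m : int, m < N -> g m = 0 &
     f = qshift kappa (of_int_series g)].

Definition nahm_exponent (d : nat) (B : 'M[rat]_d) (b : 'cV[rat]_d)
    (n : 'cV[nat]_d) : rat :=
  let v := map_mx (fun k : nat => k%:R : rat) n in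
  2^-1 * (v^T *m B *m v) 0 0 + (b^T *m v) 0 0.

Definition nahm_denom (R : realType) (d : nat) (ds : 'I_d -> nat)
    (n : 'cV[nat]_d) : {poly R} :=
  \prod_(i < d) qpoch 'X^(ds i) 'X^(ds i) (n i 0).

Definition nahm_term (R : realType) (d : nat) (B : 'M[rat]_d)
    (ds : 'I_d -> nat) (b : 'cV[rat]_d) (n : 'cV[nat]_d) : qseries R :=
  qshift (nahm_exponent B b n) (of_power_series (psinv (nahm_denom R ds n))).

(* The finitely supported sum below is 0 by convention when infinitely many
   terms contribute to q^e; [nahm_well_defined] rules this out. *)
Definition nahm_series (R : realType) (d : nat) (B : 'M[rat]_d)
    (ds : 'I_d -> nat) (b : 'cV[rat]_d) : qseries R :=
  fun e => \sum_(n \in [set: 'cV[nat]_d]) nahm_term R B ds b n e.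

(* Puiseux series bounded below with locally finite coefficients *)
Definition nahm_well_defined (R : realType) (d : nat) (B : 'M[rat]_d)
    (ds : 'I_d -> nat) (b : 'cV[rat]_d) : Prop :=
  (exists (D : nat) (N : int), (0 < D)%N /\
     forall (n : 'cV[nat]_d) (e : rat), nahm_term R B ds b n e != 0 ->
       exists2 m : int, N <= m & e = m%:~R / D%:R) /\
  (forall e : rat, finite_set [set n | nahm_term R B ds b n e != 0]).

Lemma psinvP (A : comNzRingType) (p : {poly A}) : p`_0 = 1 ->
  forall m : nat, \sum_(k < m.+1) p`_k * psinv p (m - k) = (m == 0%N)%:R.
Proof.
move=> p0 m.
have [r pr] : exists r, 1 - p = r * 'X.
  have /factor_theorem[r ->] : root (1 - p) 0.
    by apply/rootP; rewrite horner_coef0 coefB coef1 p0 subrr.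
  by exists r; rewrite subr0.
have low k i : (i < k)%N -> ((1 - p) ^+ k)`_i = 0.
  by move=> ik; rewrite pr exprMn coefMXn ik.
have psE i : (i <= m)%N ->
    psinv p i = (\sum_(k < m.+1) (1 - p) ^+ k)`_i.
  move=> im; rewrite /psinv !coef_sum.
  rewrite (big_ord_widen m.+1 (fun k => ((1 - p) ^+ k)`_i)) //.
  rewrite big_mkcond /=; apply: eq_bigr => k _.
  by case: ltnP => // ik; rewrite low.
transitivity ((p * \sum_(k < m.+1) (1 - p) ^+ k)`_m).
  by rewrite coefM; apply: eq_bigr => k _; rewrite psE ?leq_subr.
have E := subrX1 (1 - p) m.+1.
have p1 : 1 - p - 1 = - p by rewrite addrAC subrr add0r.
rewrite p1 mulNr in E.
rewrite -[p * _]opprK -E opprB coefB coef1 low // subr0.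
by case: (m).
Qed.

Lemma nahm_denom0 (R : realType) (d : nat) (ds : 'I_d -> nat)
    (n : 'cV[nat]_d) : (forall i, (0 < ds i)%N) -> (nahm_denom R ds n)`_0 = 1.
Proof.
move=> ds0; rewrite -horner_coef0 horner_prod big1 // => i _.
rewrite horner_prod big1 // => k _.
by rewrite !hornerE expr0n gtn_eqF // mul0r subr0.
Qed.

(* Main.v *)
Require Import Defs.
From mathcomp Require Import all_boot all_order all_algebra.
From mathcomp Require Import all_classical all_reals.
From mathcomp Require Import ring.

Import Order.TTheory GRing.Theory Num.Theory.
Local Open Scope classical_set_scope.
Local Open Scope ring_scope.

(** All coefficients of the reciprocal denominators are nonnegative and their
constant terms are 1, so no cancellation can occur in the sum: every exponent
[c_j + Q_j(n)], with [Q_j(n) = n^T B n / 2 + b_j^T n], really appears.  Hence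
the containment says that [c_j - kappa + Q_j(n)] is always an integer.  Taking
[n = 0] gives the condition on [c_j], [n = e_i] the one on [b_j], and
[Q_j(e_i + e_k) - Q_j(e_i) - Q_j(e_k) = B_ik] the integrality of [B].
Conversely, that polarization identity makes [Q_j] integral on the monoid
generated by the [e_i]. *)

(** Truncated form of the statement that the power series 1/p has nonnegative coefficients. It stays
    within polynomials and passes to products; the sign of [s] is left free. *)
Definition nneg_inv_mod {R : numDomainType} (m : nat) (p : {poly R}) : Prop :=
  exists2 r : {poly R}, (forall i, 0 <= r`_i) &
  exists s : {poly R}, p * r = 1 + s * 'X^m.

Lemma nneg_inv_mod_prod {R : numDomainType} (m : nat) (I : Type) (l : seq I)
    (F : I -> {poly R}) :
  (forall i, nneg_inv_mod m (F i)) -> nneg_inv_mod m (\prod_(i <- l) F i).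
Proof.
move=> hF; apply: (big_ind (nneg_inv_mod m)) => //.
  exists 1; last by exists 0; rewrite mul0r addr0 mulr1.
  by move=> i; rewrite coef1 ler0n.
move=> p1 p2 [r1 r1_ge0 [s1 E1]] [r2 r2_ge0 [s2 E2]].
exists (r1 * r2).
  by move=> i; rewrite coefM sumr_ge0 // => k _; rewrite mulr_ge0.
exists (s1 + s2 + s1 * s2 * 'X^m); rewrite mulrACA E1 E2; ring.
Qed.

Lemma nneg_inv_mod_1subXn {R : numDomainType} (m a : nat) :
  (0 < a)%N -> nneg_inv_mod m (1 - 'X^a : {poly R}).
Proof.
move=> a_gt0; exists (\sum_(k < m) ('X^a) ^+ k).
  by move=> i; rewrite coef_sum sumr_ge0 // => k _; rewrite -exprM coefXn ler0n.
(* The geometric sum leaves the error -X^(am), which is divisible by X^m because a >= 1. *)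
exists (- 'X^(a * m - m)).
rewrite -opprB mulNr -subrX1 opprB mulNr -exprD -exprM subnK //.
by rewrite leq_pmull.
Qed.

(** Inverses modulo X^(m+1) are unique, so the truncated geometric series defining [psinv] agrees
    with the nonnegative inverse [r] through degree m. *)
Lemma psinv_ge0 {R : numDomainType} (m : nat) (p : {poly R}) :
  p`_0 = 1 -> nneg_inv_mod m.+1 p -> 0 <= psinv p m.
Proof.
move=> p0 [r r_ge0 [s E]]; rewrite /psinv; set S := \sum_(k < _) _.
(* As 1 - p is divisible by X, the error (1 - p)^(m+1) of the geometric series is divisible by
   X^(m+1). *)
have [u pu] : exists u, 1 - p = u * 'X.
  have /factor_theorem[u ->] : root (1 - p) 0.
    by apply/rootP; rewrite horner_coef0 coefB coef1 p0 subrr.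
  by exists u; rewrite subr0.
have pS : p * S = 1 - u ^+ m.+1 * 'X^(m.+1).
  rewrite -exprMn -pu -[RHS]opprB subrX1 -mulNr; congr (_ * _); ring.
have -> : S = r - (u ^+ m.+1 * r + S * s) * 'X^(m.+1).
  have SE : S = (p * S) * r - S * (p * r - 1) by ring.
  rewrite {1}SE pS E; ring.
by rewrite coefB coefMXn ltnSn subr0.
Qed.

Section Quadratic.
Context {d : nat} (B : 'M[rat]_d) (b : 'cV[rat]_d).

Local Notation ratv n := (map_mx (fun k : nat => k%:R : rat) (n : 'cV[nat]_d)).

Lemma nahm_exponent0 : nahm_exponent B b 0 = 0.
Proof.
rewrite /nahm_exponent.
have -> : ratv 0 = 0 by apply/matrixP => i j; rewrite !mxE.
by rewrite !mulmx0 !mxE mulr0 addr0.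
Qed.

Definition natr_delta (i : 'I_d) : 'cV[nat]_d := delta_mx i 0.

Lemma map_natr_delta (i : 'I_d) :
  ratv (natr_delta i) = delta_mx i 0.
Proof. by apply/matrixP => k l; rewrite !mxE; case: (_ && _). Qed.

Lemma mulmx_delta_delta (M : 'M[rat]_d) (i k : 'I_d) :
  ((delta_mx i 0 : 'cV_d)^T *m M *m (delta_mx k 0 : 'cV_d)) 0 0 = M i k.
Proof. by rewrite trmx_delta -rowE -colE !mxE. Qed.

Lemma nahm_exponent_delta (i : 'I_d) :
  nahm_exponent B b (natr_delta i) = b i 0 + B i i / 2.
Proof.
rewrite /nahm_exponent map_natr_delta mulmx_delta_delta -colE !mxE; ring.
Qed.

(** The linear part is additive; by symmetry of [B] the two cross terms coincide, which absorbs the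
    factor 1/2. *)
Lemma nahm_exponentD (n m : 'cV[nat]_d) : B^T = B ->
  nahm_exponent B b (n + m) = nahm_exponent B b n + nahm_exponent B b m
    + ((ratv n)^T *m B *m ratv m) 0 0.
Proof.
move=> hB; rewrite /nahm_exponent.
have -> : ratv (n + m) = ratv n + ratv m.
  by apply/matrixP => i j; rewrite !mxE natrD.
set v := ratv n; set w := ratv m.
have sym : (w^T *m B *m v) 0 0 = (v^T *m B *m w) 0 0.
  have -> : w^T *m B *m v = (v^T *m B *m w)^T.
    by rewrite !trmx_mul trmxK hB mulmxA.
  by rewrite mxE.
rewrite [(v + w)^T]linearD /= !mulmxDl !mulmxDr.
rewrite ![fun_of_matrix (_ + _) 0 0]mxE sym; by field.
Qed.

Lemma nahm_exponent_int (n : 'cV[nat]_d) : B^T = B ->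
  (forall i k, B i k \is a Num.int) ->
  (forall i, b i 0 + B i i / 2 \is a Num.int) ->
  nahm_exponent B b n \is a Num.int.
Proof.
move=> hB B_int b_int.
have closedD n1 n2 : nahm_exponent B b n1 \is a Num.int ->
    nahm_exponent B b n2 \is a Num.int ->
    nahm_exponent B b (n1 + n2) \is a Num.int.
  move=> h1 h2; rewrite nahm_exponentD // rpredD ?(rpredD h1 h2) // mxE.
  apply: rpred_sum => k _; rewrite mxE rpredM ?mxE ?rpred_nat //.
  by apply: rpred_sum => i _; rewrite !mxE rpredM ?rpred_nat.
have closed0 : nahm_exponent B b 0 \is a Num.int by rewrite nahm_exponent0.
(* Write n as the sum of the n_i e_i, then build each n_i e_i by adding e_i repeatedly. *)
rewrite (matrix_sum_delta n).
apply: (big_ind (fun n => nahm_exponent B b n \is a Num.int)) => // i _.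
rewrite big_ord1; elim: (n i 0) => [|k IH]; first by rewrite scale0r.
by rewrite -[k.+1]addn1 scalerDl scale1r closedD // nahm_exponent_delta.
Qed.

End Quadratic.

Section Terms.
Context {R : realType} {d : nat} (B : 'M[rat]_d) (b : 'cV[rat]_d).
Context (ds : 'I_d -> nat) (hds : forall i, (0 < ds i)%N).

Lemma psinv_nahm_denom_ge0 (n : 'cV[nat]_d) (m : nat) :
  0 <= psinv (nahm_denom R ds n) m.
Proof.
apply: psinv_ge0; first exact: nahm_denom0.
apply: nneg_inv_mod_prod => i; apply: nneg_inv_mod_prod => k.
by rewrite -exprM -exprD; apply: nneg_inv_mod_1subXn; rewrite addn_gt0 hds.
Qed.

Lemma nahm_term_ge0 (n : 'cV[nat]_d) (e : rat) : 0 <= nahm_term R B ds b n e.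
Proof.
rewrite /nahm_term /qshift /of_power_series.
by case: ifP => // _; exact: psinv_nahm_denom_ge0.
Qed.

Lemma nahm_term_lead (n : 'cV[nat]_d) :
  nahm_term R B ds b n (nahm_exponent B b n) = 1.
Proof.
rewrite /nahm_term /qshift subrr /of_power_series rpred0 truncn0.
by rewrite /psinv big_ord1 expr0 coef1.
Qed.

Lemma nahm_term_supp (n : 'cV[nat]_d) (e : rat) :
  nahm_term R B ds b n e != 0 -> e - nahm_exponent B b n \is a Num.nat.
Proof.
by rewrite /nahm_term /qshift /of_power_series; case: ifP; rewrite ?eqxx.
Qed.

Lemma nahm_series_ge0 (e : rat) : 0 <= nahm_series R B ds b e.
Proof. by apply: fsumr_ge0 => n _; exact: nahm_term_ge0. Qed.

(** The term of index n contributes 1 and the others are nonnegative. Local finiteness ensures that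
    the sum is not the default value 0, so that this term can be split off. *)
Lemma nahm_series_gt0 (n : 'cV[nat]_d) : nahm_well_defined R B ds b ->
  0 < nahm_series R B ds b (nahm_exponent B b n).
Proof.
move=> [_ /(_ (nahm_exponent B b n)) fin]; rewrite /nahm_series fsbig_supp.
rewrite (fsbigD1 n) /=.
- by rewrite nahm_term_lead ltr_pwDl // fsumr_ge0 // => k _; exact: nahm_term_ge0.
- by apply: sub_finite_set fin => k [_ /eqP].
- by split => //; rewrite nahm_term_lead; apply/eqP/oner_neq0.
Qed.

Lemma nahm_series_supp (e : rat) : nahm_series R B ds b e != 0 ->
  exists n, nahm_term R B ds b n e != 0.
Proof.
move=> se; apply: contrapT => /forallNP h; case/eqP: se.
by apply: fsbig1 => n _; apply/eqP; apply: contrapT => /negP; exact: h.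
Qed.

Lemma nahm_series_lbound : nahm_well_defined R B ds b ->
  exists N : int, forall e, nahm_series R B ds b e != 0 -> N%:~R <= e.
Proof.
move=> [[D [N [D_gt0 h]]] _]; exists (Num.floor (N%:~R / D%:R : rat)).
move=> e /nahm_series_supp[n /h[m Nm ->]].
by rewrite (le_trans (floor_le _)) // ler_pM2r ?ler_int // invr_gt0 ltr0n.
Qed.

End Terms.

(** Turns membership into two conditions on the support alone, the form used in both directions of
    the theorem. *)
Lemma qLaurentP {R : realType} (kappa : rat) (f : qseries R) :
  f \in qLaurent kappa <->
  (forall e, f e != 0 -> e - kappa \is a Num.int) /\
  (exists N : int, forall e, f e != 0 -> N%:~R <= e - kappa).
Proof.
rewrite inE; split=> [[g [N gN] ->]|[f_int [N fN]]].
  rewrite /qshift /of_int_series; split=> [e|]; first by case: ifP; rewrite ?eqxx.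
  exists N => e; case: ifP => [e_int|]; last by rewrite eqxx.
  by rewrite -floor_ge_int leNgt; apply: contra_neqN => /gN.
(* The Laurent coefficients are the values of [f] on the coset kappa + Z. *)
exists (fun m : int => f (m%:~R + kappa)).
  exists N => m; apply: contraTeq => /fN.
  by rewrite addrK ler_int -leNgt.
apply/funext => e; rewrite /qshift /of_int_series.
case: ifP => [e_int|/negbT e_int]; first by rewrite floorK // subrK.
by apply/eqP; apply: contraNT e_int => /f_int.
Qed.

Theorem proposition2p1 (R : realType) (d : nat) (hd : (1 <= d)%N)
    (B : 'M[rat]_d) (hB : B^T = B)
    (ds : 'I_d -> nat) (hds : forall i : 'I_d, (0 < ds i)%N)
    (t : nat) (ht : (1 <= t)%N)
    (lambda : 'I_t -> R) (hlambda : forall j : 'I_t, 0 < lambda j)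
    (b : 'I_t -> 'cV[rat]_d) (c : 'I_t -> rat) (kappa : rat)
    (hN : forall j : 'I_t, nahm_well_defined R B ds (b j)) :
  let S : qseries R := fun e : rat =>
    \sum_(j < t) lambda j * qshift (c j) (nahm_series R B ds (b j)) e in
  let B_integral := forall i k : 'I_d, B i k \is a Num.int in
  let bc_conditions := forall j : 'I_t,
    c j - kappa \is a Num.int /\
    forall i : 'I_d, b j i 0 + B i i / 2 \is a Num.int in
  (S \in qLaurent kappa -> B_integral /\ bc_conditions) /\
  (bc_conditions /\ B_integral -> S \in qLaurent kappa).
Proof.
move=> S B_integral bc_conditions.
have S_supp e : S e != 0 ->
    exists j, nahm_series R B ds (b j) (e - c j) != 0.
  move=> Se; apply: contrapT => /forallNP h; case/eqP: Se.
  rewrite /S big1 // => j _; rewrite /qshift.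
  by have /negP/negPn/eqP -> := h j; rewrite mulr0.
split=> [/qLaurentP[S_int _]|[bc B_int]].
  (* The coefficient of [S] at c_j + Q_j(n) is positive: summand j is positive there and the others
     are nonnegative. *)
  have cQ_int j n : c j - kappa + nahm_exponent B (b j) n \is a Num.int.
    rewrite addrAC [c j + _]addrC; apply: S_int; rewrite gt_eqF //.
    rewrite /S (bigD1 j) //= ltr_pwDl //.
      by rewrite mulr_gt0 // /qshift addrK nahm_series_gt0.
    apply: sumr_ge0 => k _; apply: mulr_ge0; [exact: ltW | exact: nahm_series_ge0].
  have c_int j : c j - kappa \is a Num.int.
    by have := cQ_int j 0; rewrite nahm_exponent0 addr0.
  have Q_int j n : nahm_exponent B (b j) n \is a Num.int.
    by have := cQ_int j n; rewrite rpredDl.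
  split=> [i k|j]; last by split=> // i; rewrite -nahm_exponent_delta.
  (* The cross term B_ik does not depend on j, so any index serves; t >= 1 supplies the first. *)
  have := Q_int (Ordinal ht) (natr_delta i + natr_delta k).
  rewrite nahm_exponentD // !map_natr_delta mulmx_delta_delta rpredDl //; exact: rpredD.
apply/qLaurentP; split=> [e /S_supp[j /nahm_series_supp[n /nahm_term_supp]]|].
  move=> /intr_nat h; have [c_int b_int] := bc j.
  (* The first summand is the natural exponent coming from the expanded reciprocal denominator. *)
  have -> : e - kappa = (e - c j - nahm_exponent B (b j) n) + (c j - kappa)
      + nahm_exponent B (b j) n by ring.
  by apply: rpredD; [exact: rpredD | exact: nahm_exponent_int].
have /choice[N hNe] j := nahm_series_lbound _ _ _ (hN j).
pose L j : rat := (N j)%:~R + (c j - kappa).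
(* One bound for all j: each [Num.bound (L j)] is a natural number exceeding -L_j, so minus their
   sum lies below every L_j. *)
exists (- (\sum_(j < t) Num.bound (L j))%:Z) => e /S_supp[j /hNe Nj].
apply: (@le_trans _ _ (L j)).
  rewrite mulrNz lerNl (le_trans (ltW (unstable.ltrNbound _))) //.
  by rewrite ler_nat (bigD1 j) //= leq_addr.
by move: Nj; rewrite lerBrDr /L addrA => Nj; exact: lerB.
Qed.
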